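(* Let $m$ and $F$ be two integers with $(m,F)\neq(1,-1)$. Then $\mathscr L(m,F)\neq\varnothing$ if and only if $F\geq m-1\geq 1$ and $m\nmid F$.
   Context: $\mathbb N$ denotes the non-negative integers. A numerical semigroup is a submonoid $S$ of $(\mathbb N,+)$ with $\mathbb N\setminus S$ finite. Its multiplicity $\operatorname{m}(S)$ is the smallest positive integer in $S$; its Frobenius number $\operatorname{F}(S)$ is the largest integer not in $S$ (so $\operatorname{F}(\mathbb N)=-1$). $\mathscr L(m,F)$ is the set of all numerical semigroups with multiplicity $m$ and Frobenius number $F$. *)

(* Defs.v *)
From HB Require Import structures.
From mathcomp Require Import all_boot all_order all_algebra.
From mathcomp Require Import classical_sets cardinality.
Set Implicit Arguments.
Unset Strict Implicit.
Unset Printing Implicit Defensive.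
Import Order.TTheory GRing.Theory Num.Theory.
Local Open Scope classical_set_scope.
Local Open Scope ring_scope.

Definition numerical_semigroup (S : set nat) : Prop :=
  [/\ S 0%N,
      (forall a b : nat, S a -> S b -> S (a + b)%N) &
      finite_set (~` S)].

(* A set of naturals seen as a set of integers. Multiplicity and Frobenius
   number are integers: every negative integer lies outside [S], so the
   Frobenius number of [setT] is [-1]. *)
Definition intset (S : set nat) : set int := [set n%:Z | n in S].

Definition is_multiplicity (S : set nat) (m : int) : Prop :=
  [/\ intset S m, 0 < m & forall x : int, intset S x -> 0 < x -> m <= x].

Definition is_frobenius (S : set nat) (F : int) : Prop :=
  ~ intset S F /\ forall x : int, ~ intset S x -> x <= F.

(* Both [is_multiplicity S] and [is_frobenius S] determine a unique integer
   when [S] is a numerical semigroup, so they express m(S) = m, F(S) = F. *)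
Definition semigroups_mF (m F : int) : set (set nat) :=
  [set S | [/\ numerical_semigroup S, is_multiplicity S m
             & is_frobenius S F]].

(* Main.v *)
(* For existence take the smallest candidate: the multiples of m together with
   all integers beyond F.  Conversely 1, ..., m - 1 are gaps and multiples of m
   are not, while m = 1 forces S = N and F = -1. *)
Require Import Defs.
From HB Require Import structures.
From mathcomp Require Import all_boot all_order all_algebra.
From mathcomp Require Import classical_sets cardinality.
From mathcomp Require Import zify.
Import Order.TTheory GRing.Theory Num.Theory.
Local Open Scope classical_set_scope.
Local Open Scope ring_scope.

Lemma intset_nat (S : set nat) (n : nat) : intset S n%:Z <-> S n.
Proof. by split=> [[k Sk [<-]]|Sn] //; exists n. Qed.

Lemma intset_ge0 (S : set nat) (x : int) : intset S x -> 0 <= x.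
Proof. by case=> n _ <-. Qed.

Lemma numerical_semigroup_dvdn (S : set nat) (m n : nat) :
  numerical_semigroup S -> S m -> (m %| n)%N -> S n.
Proof.
move=> [S0 SD _] Sm /dvdnP[k ->].
by elim: k => [|k IHk]; rewrite ?mul0n // mulSn; apply: SD.
Qed.

Definition multiples_or_above (m f : nat) : set nat :=
  [set n | (m %| n)%N || (f < n)%N].

(** Two multiples of [m] add up to a multiple; any other sum exceeds [f]. All gaps are at most [f],
    hence finitely many. *)
Lemma numerical_semigroup_multiples_or_above (m f : nat) :
  numerical_semigroup (multiples_or_above m f).
Proof.
split=> [|a b /orP[ma|fa] /orP[mb|fb]|]; rewrite /multiples_or_above /=.
- by rewrite dvdn0.
- by rewrite dvdn_add.
- by apply/orP; right; lia.
- by apply/orP; right; lia.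
- by apply/orP; right; lia.
- apply: (@sub_finite_set _ _ `I_f.+1); last exact: finite_II.
  by move=> n /= /negP; rewrite negb_or -leqNgt => /andP[].
Qed.

(** Elements beyond [f] are at least [f.+1], so [m <= f.+1] keeps them from undercutting [m]. *)
Lemma is_multiplicity_multiples_or_above (m f : nat) :
  (0 < m)%N -> (m <= f.+1)%N -> is_multiplicity (multiples_or_above m f) m%:Z.
Proof.
move=> m_gt0 le_mf; split=> //.
  by apply/intset_nat; rewrite /multiples_or_above /= dvdnn.
move=> _ [n /orP[mn|fn] <-] n_gt0; rewrite lez_nat; last by lia.
exact: dvdn_leq.
Qed.

(** Non-divisibility makes [f] a gap; the negative integers are gaps too, but lie below [f]. *)
Lemma is_frobenius_multiples_or_above (m f : nat) :
  ~~ (m %| f)%N -> is_frobenius (multiples_or_above m f) f%:Z.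
Proof.
move=> mf; split=> [/intset_nat|[n|n] Sn] //.
  by rewrite /multiples_or_above /= (negPf mf) ltnn.
rewrite lez_nat leqNgt; apply/negP => fn; apply: Sn; apply/intset_nat.
by rewrite /multiples_or_above /= fn orbT.
Qed.

Lemma is_frobenius_setT (F : int) : is_frobenius setT F -> F = -1.
Proof.
move=> [TF maxF]; have: (-1 : int) <= F by apply: maxF => /intset_ge0.
by case: F TF {maxF} => [n []|n _]; [apply/intset_nat|lia].
Qed.

Theorem proposition3 (m F : int) (hmF : (m, F) <> (1, -1)) :
  semigroups_mF m F <> set0 <->
  [/\ F >= m - 1, m - 1 >= 1 & ~~ (m %| F)%Z].
Proof.
split=> [/eqP/set0P[S [semiS [Sm m_gt0 minm] [SF maxF]]]|[le_mF m_gt1 mF]].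
- have m_neq1 : m <> 1.
    move=> m1; apply: hmF; rewrite m1; congr pair; apply: is_frobenius_setT.
    (* Here 1 lies in [S] and divides every natural number, so [S] is everything. *)
    suff <- : S = setT by [].
    rewrite -subTset => n _.
    apply: (@numerical_semigroup_dvdn _ 1%N) => //.
    by apply/intset_nat; move: Sm; rewrite m1.
  (* As [m >= 2], the integer [m - 1] is positive and below the multiplicity, hence a gap. *)
  have le_mF : m - 1 <= F.
    apply: maxF => Sm1; have := minm _ Sm1; lia.
  split=> //; first by lia.
  (* Since [F >= m - 1 >= 1], both integers are naturals; if [m] divided [F], then [F] would lie in
     [S]. *)
  case: m Sm F SF le_mF m_gt0 m_neq1 {hmF minm maxF}
    => [m|m] // /intset_nat Sm [f|f] SF le_mF m_gt0 m_neq1; last by lia.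
  apply/negP; rewrite dvdzE /= => mf; apply/SF/intset_nat.
  exact: numerical_semigroup_dvdn mf.
- apply/eqP/set0P.
  (* The bounds rule out negative [m] and [F], so the natural-number construction applies. *)
  case: m F mF le_mF m_gt1 {hmF} => [m|m] [f|f] mF le_mF m_gt1; try by lia.
  exists (multiples_or_above m f); split.
  + exact: numerical_semigroup_multiples_or_above.
  + by apply: is_multiplicity_multiples_or_above; lia.
  + by apply: is_frobenius_multiples_or_above; rewrite dvdzE in mF.
Qed.
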